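(* Let $n,d\ge1$ be integers. Let $\Lambda_n^{(d)}$ be the $\mathbb{Q}$-vector space of symmetric polynomials in $x_1,\dots,x_n$ whose degree in each variable does not exceed $d$, with the $\mathfrak{sl}_2$-action $$\mathfrak{e}_+\mapsto\sum_{k=1}^n\Big(-x_k^2\frac{\partial}{\partial x_k}+d\,x_k\Big),\qquad \mathfrak{h}\mapsto 2\sum_{k=1}^n x_k\frac{\partial}{\partial x_k}-nd,\qquad \mathfrak{e}_-\mapsto\sum_{k=1}^n\frac{\partial}{\partial x_k}.$$ Then $\Lambda_n^{(d)}$ is a finite-dimensional $\mathfrak{sl}_2$-submodule of the space $\Lambda_n$ of all symmetric polynomials in $x_1,\dots,x_n$ over $\mathbb{Q}$ (with the action given by the same formulas), and it is isomorphic as an $\mathfrak{sl}_2$-module to the symmetric power $\mathrm{Sym}^n(V_d)$.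
   Context: $\mathfrak{sl}_2$ has basis $\mathfrak{e}_-,\mathfrak{h},\mathfrak{e}_+$ with $[\mathfrak{h},\mathfrak{e}_+]=2\mathfrak{e}_+$, $[\mathfrak{h},\mathfrak{e}_-]=-2\mathfrak{e}_-$, $[\mathfrak{e}_+,\mathfrak{e}_-]=\mathfrak{h}$; an $\mathfrak{sl}_2$-module is a $\mathbb{Q}$-vector space with three endomorphisms (the images of these basis elements) satisfying these relations. $V_d$ denotes the standard irreducible $\mathfrak{sl}_2$-module of dimension $d+1$ with basis $v_0,\dots,v_d$ and action $\mathfrak{e}_+v_i=(d-i)v_{i+1}$, $\mathfrak{h}v_i=(2i-d)v_i$, $\mathfrak{e}_-v_i=i\,v_{i-1}$ (with $v_{-1}=v_{d+1}=0$). $\mathrm{Sym}^n(V_d)$ is the degree-$n$ component of the symmetric algebra of $V_d$, on which $\mathfrak{sl}_2$ acts by derivations extending the action on $V_d$. *)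

(* Defs.v *)
From HB Require Import structures.
From mathcomp Require Import all_boot all_order all_algebra all_fingroup.
From mathcomp Require Import mpoly ring.

Set Implicit Arguments.
Unset Strict Implicit.
Unset Printing Implicit Defensive.

Import GRing.Theory.

Local Open Scope ring_scope.

Record sl2Action (V : lmodType rat) := Sl2Action {
  e_plus : {linear V -> V};
  h_act : {linear V -> V};
  e_minus : {linear V -> V};
  sl2_h_plus : forall v, h_act (e_plus v) - e_plus (h_act v) = 2%:R *: e_plus v;
  sl2_h_minus :
    forall v, h_act (e_minus v) - e_minus (h_act v) = - (2%:R *: e_minus v);
  sl2_plus_minus : forall v, e_plus (e_minus v) - e_minus (e_plus v) = h_act v
}.

Record sl2_submodule (V : lmodType rat) (A : sl2Action V) (S : pred V) : Prop :=
  Sl2Submodule {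
    sub_closed : submod_closed S;
    sub_plus : forall v, v \in S -> e_plus A v \in S;
    sub_h : forall v, v \in S -> h_act A v \in S;
    sub_minus : forall v, v \in S -> e_minus A v \in S
  }.

Definition sl2_isomorphic (V W : lmodType rat)
    (A : sl2Action V) (B : sl2Action W) : Prop :=
  exists f : {linear V -> W},
    [/\ bijective f,
        forall v, f (e_plus A v) = e_plus B (f v),
        forall v, f (h_act A v) = h_act B (f v)
      & forall v, f (e_minus A v) = e_minus B (f v)].

Definition finite_dimensional (V : lmodType rat) : Prop :=
  exists m : nat, inhabited (Vector.axiom m V).

Section Restriction.
Context (V : lmodType rat) (S : pred V).

(* The proof K is a parameter of the type, so that the closure properties it
   asserts equip the subtype with its vector space structure. *)
Record sub_space (K : submod_closed S) :=
  SubSpace { sub_vec : V; _ : S sub_vec }.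

Section Space.
Context (K : submod_closed S).

HB.instance Definition _ := [isSub for @sub_vec K].
HB.instance Definition _ := [Choice of sub_space K by <:].
HB.instance Definition _ :=
  GRing.SubChoice_isSubLmodule.Build rat V S (sub_space K) K.

Definition sub_map (f : V -> V) (Sf : forall v, v \in S -> f v \in S)
  (u : sub_space K) : sub_space K := SubSpace K (Sf (val u) (valP u)).

Lemma sub_map_is_linear (f : {linear V -> V}) Sf : linear (@sub_map f Sf).
Proof. by move=> c u v; apply: val_inj; rewrite /= linearP. Qed.

HB.instance Definition _ (f : {linear V -> V}) Sf :=
  GRing.isLinear.Build rat (sub_space K) (sub_space K) _
    (@sub_map f Sf) (@sub_map_is_linear f Sf).

End Space.

Context (A : sl2Action V) (H : sl2_submodule A S).

Definition sub_action : sl2Action (sub_space (sub_closed H)).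
Proof.
exists (sub_map (K := sub_closed H) (sub_plus H)) (sub_map (K := sub_closed H) (sub_h H))
       (sub_map (K := sub_closed H) (sub_minus H)) => u; apply: val_inj => /=.
- exact: sl2_h_plus.
- exact: sl2_h_minus.
- exact: sl2_plus_minus.
Defined.

End Restriction.

Section VectorField.
Context {n : nat}.
Implicit Types (p q : {mpoly rat[n]}) (u : 'I_n -> {mpoly rat[n]}).

(* The derivation mapping the variable 'X_k to u k. *)
Definition vfield u p : {mpoly rat[n]} := \sum_(k < n) u k * p^`M(k).

Lemma vfield_is_linear u : linear (vfield u).
Proof.
move=> c p q; rewrite /vfield scaler_sumr -big_split /=.
by apply: eq_bigr => k _; rewrite linearP mulrDr scalerAr.
Qed.

HB.instance Definition _ u :=
  GRing.isLinear.Build rat {mpoly rat[n]} {mpoly rat[n]} _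
    (vfield u) (vfield_is_linear u).

Lemma vfieldM u p q : vfield u (p * q) = vfield u p * q + p * vfield u q.
Proof.
rewrite /vfield mulr_suml mulr_sumr -big_split /=.
by apply: eq_bigr => k _; rewrite mderivM; ring.
Qed.

Lemma mderivXi (i k : 'I_n) : ('X_i : {mpoly rat[n]})^`M(k) = (i == k)%:R.
Proof.
rewrite mderivX mnm1E; case: eqP => [->|_]; last by rewrite scale0r.
rewrite scale1r -mpolyX0; congr 'X_[_]; apply/mnmP => j.
by rewrite mnmBE mnm0E subnn.
Qed.

Lemma vfieldX u i : vfield u 'X_i = u i.
Proof.
rewrite /vfield (bigD1 i) //= mderivXi eqxx mulr1 big1 ?addr0 // => k ki.
by rewrite mderivXi eq_sym (negPf ki) mulr0.
Qed.

Lemma derivation1 (D : {linear {mpoly rat[n]} -> {mpoly rat[n]}}) :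
  (forall p q, D (p * q) = D p * q + p * D q) -> D 1 = 0.
Proof.
move=> DM; apply: (addrI (D 1)).
by have := DM 1 1; rewrite !mulr1 mul1r addr0 => <-.
Qed.

(* A derivation of a polynomial ring is determined by its values on the
   variables. *)
Lemma derivation_vfield (D : {linear {mpoly rat[n]} -> {mpoly rat[n]}}) u :
  (forall p q, D (p * q) = D p * q + p * D q) -> (forall i, D 'X_i = u i) ->
  D =1 vfield u.
Proof.
move=> DM DX p; have D1 := derivation1 DM.
have E1 : vfield u 1 = 0 := derivation1 (vfieldM u).
elim/mpolyind: p => [|c m p _ _ IH]; first by rewrite !linear0.
rewrite !linearP /= IH; congr (_ *: _ + _); rewrite mpolyXE_id.
elim/big_rec: _ => [|i q _ IHq]; first by rewrite D1 E1.
rewrite DM vfieldM IHq; congr (_ * q + _).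
elim: (m i) => [|k IHk]; first by rewrite expr0 D1 E1.
by rewrite exprS DM vfieldM IHk DX vfieldX.
Qed.

Definition vbracket u w (i : 'I_n) := vfield u (w i) - vfield w (u i).

Lemma vfield_bracket u w p :
  vfield u (vfield w p) - vfield w (vfield u p) = vfield (vbracket u w) p.
Proof.
pose D q := vfield u (vfield w q) - vfield w (vfield u q).
have DL : linear D.
  by move=> c q r; rewrite /D !linearP /= addrACA -scalerDr.
pose DD := HB.pack_for {linear {mpoly rat[n]} -> {mpoly rat[n]}} D
  (GRing.isLinear.Build rat {mpoly rat[n]} {mpoly rat[n]} *:%R D DL).
apply: (@derivation_vfield DD (vbracket u w)) => [q r|i] /=; rewrite /D.
  by rewrite !vfieldM !linearD /= !vfieldM; ring.
by rewrite !vfieldX.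
Qed.

Lemma eq_vfield u w : u =1 w -> vfield u =1 vfield w.
Proof. by move=> uw p; apply: eq_bigr => k _; rewrite uw. Qed.

Lemma vfieldZl c u p : vfield (fun i => c *: u i) p = c *: vfield u p.
Proof. by rewrite /vfield scaler_sumr; apply: eq_bigr => k _; rewrite scalerAl. Qed.

End VectorField.

Section PolynomialAction.
Context (n d : nat).
Implicit Types p : {mpoly rat[n]}.

Definition poly_plus p : {mpoly rat[n]} :=
  \sum_(k < n) (- ('X_k ^+ 2 * p^`M(k)) + d%:R *: ('X_k * p)).

Definition poly_h p : {mpoly rat[n]} :=
  2%:R *: (\sum_(k < n) 'X_k * p^`M(k)) - (n * d)%:R *: p.

Definition poly_minus p : {mpoly rat[n]} := \sum_(k < n) p^`M(k).

Let sq (k : 'I_n) : {mpoly rat[n]} := - 'X_k ^+ 2.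
Let euler (k : 'I_n) : {mpoly rat[n]} := 'X_k.
Let one (k : 'I_n) : {mpoly rat[n]} := 1.
Let e1 : {mpoly rat[n]} := \sum_(k < n) 'X_k.

Lemma poly_plusE p : poly_plus p = vfield sq p + d%:R *: (e1 * p).
Proof.
rewrite /poly_plus big_split /= /e1 mulr_suml scaler_sumr; congr (_ + _).
by apply: eq_bigr => k _; rewrite mulNr.
Qed.

Lemma poly_minusE p : poly_minus p = vfield one p.
Proof. by apply: eq_bigr => k _; rewrite mul1r. Qed.

Lemma poly_plus_is_linear : linear poly_plus.
Proof.
move=> c p q; rewrite !poly_plusE linearP /= mulrDr scalerDr -scalerAr.
by rewrite scalerDr addrACA !scalerA [d%:R * c]mulrC.
Qed.

Lemma poly_h_is_linear : linear poly_h.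
Proof.
move=> c p q; rewrite /poly_h -/(vfield euler _) linearP /= !scalerDr !scalerN.
by rewrite opprD addrACA !scalerA ![c * _]mulrC.
Qed.

Lemma poly_minus_is_linear : linear poly_minus.
Proof. by move=> c p q; rewrite !poly_minusE linearP. Qed.

HB.instance Definition _ := GRing.isLinear.Build rat {mpoly rat[n]}
  {mpoly rat[n]} _ poly_plus poly_plus_is_linear.
HB.instance Definition _ := GRing.isLinear.Build rat {mpoly rat[n]}
  {mpoly rat[n]} _ poly_h poly_h_is_linear.
HB.instance Definition _ := GRing.isLinear.Build rat {mpoly rat[n]}
  {mpoly rat[n]} _ poly_minus poly_minus_is_linear.

Lemma vfield_e1 u : vfield u e1 = \sum_(k < n) u k.
Proof. by rewrite linear_sum /=; apply: eq_bigr => k _; rewrite vfieldX. Qed.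

Lemma vfield1 u : vfield u 1 = 0 :> {mpoly rat[n]}.
Proof. exact: (derivation1 (vfieldM u)). Qed.

Lemma poly_h_plus p :
  poly_h (poly_plus p) - poly_plus (poly_h p) = 2%:R *: poly_plus p.
Proof.
rewrite !poly_plusE /poly_h -!/(vfield euler _).
have E : vfield euler (vfield sq p) = vfield sq (vfield euler p) + vfield sq p.
  apply/eqP; rewrite addrC -subr_eq; apply/eqP.
  rewrite vfield_bracket; apply: eq_vfield => i.
  by rewrite /vbracket linearN /= expr2 vfieldM !vfieldX /euler /sq; ring.
rewrite !linearD !linearN !linearZ /= vfieldM vfield_e1 -/e1 E.
rewrite -!mul_mpolyC; ring.
Qed.

Lemma poly_h_minus p :
  poly_h (poly_minus p) - poly_minus (poly_h p) = - (2%:R *: poly_minus p).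
Proof.
rewrite !poly_minusE /poly_h -!/(vfield euler _).
have E : vfield euler (vfield one p) = vfield one (vfield euler p) - vfield one p.
  apply/eqP; rewrite addrC -subr_eq; apply/eqP.
  rewrite vfield_bracket -scaleN1r -vfieldZl; apply: eq_vfield => i.
  by rewrite /vbracket vfield1 vfieldX sub0r scaleN1r.
rewrite !linearD !linearN !linearZ /= E.
rewrite -!mul_mpolyC; ring.
Qed.

Lemma poly_plus_minus p :
  poly_plus (poly_minus p) - poly_minus (poly_plus p) = poly_h p.
Proof.
rewrite !poly_plusE !poly_minusE /poly_h -/(vfield euler _).
have E : vfield sq (vfield one p) =
         vfield one (vfield sq p) + 2%:R *: vfield euler p.
  apply/eqP; rewrite addrC -subr_eq; apply/eqP.
  rewrite vfield_bracket -vfieldZl; apply: eq_vfield => i.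
  rewrite /vbracket vfield1 linearN /= expr2 vfieldM !vfieldX /euler /one.
  by rewrite -mul_mpolyC; ring.
rewrite !linearD !linearZ /= vfieldM vfield_e1 E.
rewrite sumr_const card_ord natrM -!mul_mpolyC; ring.
Qed.

Definition poly_action : sl2Action {mpoly rat[n]} :=
  Sl2Action poly_h_plus poly_h_minus poly_plus_minus.

End PolynomialAction.

Section SymmetricPolynomials.
Context (n : nat).
Implicit Types p : {mpoly rat[n]}.

Definition is_sym : pred {mpoly rat[n]} := fun p => p \is symmetric.

Lemma symmetric_closed : submod_closed is_sym.
Proof. exact: sym_submod_closed. Qed.

Lemma msym_mderiv (s : 'S_n) p k : msym s p^`M(k) = (msym s p)^`M(s k).
Proof.
apply/mpolyP => m; rewrite mcoeff_sym !mcoeff_deriv mcoeff_sym mnmE.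
congr (p@_ _ *+ _); apply/mnmP => i.
by rewrite mnmDE !mnmE (inj_eq perm_inj).
Qed.

Lemma msym_var (s : 'S_n) (k : 'I_n) :
  msym s ('X_k : {mpoly rat[n]}) = 'X_(s k).
Proof.
rewrite msymX; congr 'X_[_]; apply/mnmP => i.
by rewrite !mnmE -(inj_eq (@perm_inj _ s)) permKV.
Qed.

Lemma symmetric_plus d p :
  p \in is_sym -> poly_plus d p \in is_sym.
Proof.
move/issymP => sp; apply/issymP => s; rewrite /poly_plus linear_sum /=.
rewrite [RHS](reindex_inj (@perm_inj _ s)) /=; apply: eq_bigr => k _.
by rewrite linearD linearN linearZ /= !rmorphM /= msym_var msym_mderiv sp.
Qed.

Lemma symmetric_h d p :
  p \in is_sym -> poly_h d p \in is_sym.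
Proof.
move/issymP => sp; apply/issymP => s.
rewrite /poly_h linearB !linearZ linear_sum /= sp; congr (_ *: _ + _).
rewrite [RHS](reindex_inj (@perm_inj _ s)) /=; apply: eq_bigr => k _.
by rewrite rmorphM /= msym_var msym_mderiv sp.
Qed.

Lemma symmetric_minus p :
  p \in is_sym -> poly_minus p \in is_sym.
Proof.
move/issymP => sp; apply/issymP => s; rewrite /poly_minus linear_sum /=.
rewrite [RHS](reindex_inj (@perm_inj _ s)) /=; apply: eq_bigr => k _.
by rewrite msym_mderiv sp.
Qed.

Definition Lambda_submodule (d : nat) :
    sl2_submodule (poly_action n d) is_sym :=
  @Sl2Submodule _ (poly_action n d) _ symmetric_closed (@symmetric_plus d)
    (@symmetric_h d) symmetric_minus.

Definition Lambda : lmodType rat := sub_space symmetric_closed.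

Definition Lambda_action (d : nat) : sl2Action Lambda :=
  sub_action (Lambda_submodule d).

(* The degree of q in each variable is at most d. *)
Definition Lambda_deg_le (d : nat) : pred Lambda :=
  fun q => all (fun m : 'X_{1..n} => [forall k, (m k <= d)%N]) (msupp (val q)).

End SymmetricPolynomials.

Section LinearExtension.
Context (m : nat).

Definition lin_ext (W : lmodType rat) (g : 'I_m -> W) (w : 'rV[rat]_m) : W :=
  \sum_(i < m) w 0 i *: g i.

Lemma lin_ext_is_linear W g : linear (@lin_ext W g).
Proof.
move=> c u v; rewrite /lin_ext scaler_sumr -big_split /=.
by apply: eq_bigr => i _; rewrite !mxE scalerDl scalerA.
Qed.

HB.instance Definition _ (W : lmodType rat) g := GRing.isLinear.Build rat 'rV[rat]_m W _
  (@lin_ext W g) (@lin_ext_is_linear W g).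

Lemma lin_ext_delta W g i : @lin_ext W g (delta_mx 0 i) = g i.
Proof.
rewrite /lin_ext (bigD1 i) //= mxE !eqxx scale1r big1 ?addr0 // => j ji.
by rewrite mxE (negPf ji) andbF scale0r.
Qed.

Lemma linear_delta (W : lmodType rat) (f : {linear 'rV[rat]_m -> W}) :
  f =1 lin_ext (fun i => f (delta_mx 0 i)).
Proof.
move=> w; rewrite {1}[w]row_sum_delta linear_sum /=.
by apply: eq_bigr => i _; rewrite linearZ.
Qed.

End LinearExtension.

Section StandardModule.
Context (d : nat).

(* The vector v_i; it is zero for i > d. *)
Definition V_basis (i : nat) : 'rV[rat]_d.+1 := \row_j (j == i :> nat)%:R.

Definition V_plus : 'rV[rat]_d.+1 -> 'rV[rat]_d.+1 :=
  lin_ext (fun i => (d%:R - i%:R) *: V_basis i.+1).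

Definition V_h : 'rV[rat]_d.+1 -> 'rV[rat]_d.+1 :=
  lin_ext (fun i => ((2 * i)%:R - d%:R) *: V_basis i).

(* For i = 0 the truncated index i.-1 is harmless, as the coefficient is 0. *)
Definition V_minus : 'rV[rat]_d.+1 -> 'rV[rat]_d.+1 :=
  lin_ext (fun i => i%:R *: V_basis i.-1).

HB.instance Definition _ := GRing.Linear.on V_plus.
HB.instance Definition _ := GRing.Linear.on V_h.
HB.instance Definition _ := GRing.Linear.on V_minus.

Lemma V_basisE (i : 'I_d.+1) : V_basis i = delta_mx 0 i.
Proof. by apply/rowP => j; rewrite !mxE eqxx. Qed.

Lemma V_basis0 i : (d < i)%N -> V_basis i = 0.
Proof.
move=> di; apply/rowP => j; rewrite !mxE; case: eqP => // ji.
by move: (ltn_ord j); rewrite ji ltnS leqNgt di.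
Qed.

Lemma V_plusE i : (i <= d)%N -> V_plus (V_basis i) = (d%:R - i%:R) *: V_basis i.+1.
Proof.
by move=> id; rewrite -[i]/(nat_of_ord (Ordinal (id : i < d.+1)%N)) V_basisE /V_plus lin_ext_delta.
Qed.

Lemma V_hE i : V_h (V_basis i) = ((2 * i)%:R - d%:R) *: V_basis i.
Proof.
case: (leqP i d) => [id | di]; last by rewrite V_basis0 // linear0 scaler0.
by rewrite -[i]/(nat_of_ord (Ordinal (id : i < d.+1)%N)) V_basisE /V_h lin_ext_delta V_basisE.
Qed.

Lemma V_minusE i : (i <= d)%N -> V_minus (V_basis i) = i%:R *: V_basis i.-1.
Proof.
by move=> id; rewrite -[i]/(nat_of_ord (Ordinal (id : i < d.+1)%N)) V_basisE /V_minus lin_ext_delta.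
Qed.

Lemma V_ext (f g : {linear 'rV[rat]_d.+1 -> 'rV[rat]_d.+1}) :
  (forall i, (i <= d)%N -> f (V_basis i) = g (V_basis i)) -> f =1 g.
Proof.
move=> fg w; rewrite [w]row_sum_delta (linear_sum f) (linear_sum g) /=.
by apply: eq_bigr => i _; rewrite !linearZ /= -V_basisE fg // -ltnS.
Qed.

Lemma V_h_plus v : V_h (V_plus v) - V_plus (V_h v) = 2%:R *: V_plus v.
Proof.
apply/eqP; rewrite subr_eq; apply/eqP.
apply: (@V_ext (V_h \o V_plus) ((2%:R \*: V_plus) \+ (V_plus \o V_h))) => i id /=.
rewrite V_hE linearZ /= V_plusE // linearZ /= V_hE !scalerA -scalerDl.
by congr (_ *: _); rewrite mulnS natrD; ring.
Qed.

Lemma V_h_minus v : V_h (V_minus v) - V_minus (V_h v) = - (2%:R *: V_minus v).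
Proof.
apply/eqP; rewrite subr_eq -scaleNr; apply/eqP.
apply: (@V_ext (V_h \o V_minus) ((- 2%:R \*: V_minus) \+ (V_minus \o V_h))) => i id /=.
rewrite V_hE linearZ /= V_minusE // linearZ /= V_hE !scalerA -scalerDl.
by case: i id => [|i] _; congr (_ *: _) => /=; rewrite ?mulnS ?natrD; ring.
Qed.

Lemma V_plus_minus v : V_plus (V_minus v) - V_minus (V_plus v) = V_h v.
Proof.
apply/eqP; rewrite subr_eq; apply/eqP.
apply: (@V_ext (V_plus \o V_minus) (V_h \+ (V_minus \o V_plus))) => i id /=.
rewrite V_hE V_minusE // V_plusE // !linearZ /=.
have -> : (d%:R - i%:R) *: V_minus (V_basis i.+1) =
    ((d%:R - i%:R) * i.+1%:R) *: V_basis i :> 'rV_d.+1.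
  case: (ltngtP i d) id => // [id _|-> _]; last by rewrite subrr mul0r !scale0r.
  by rewrite V_minusE // scalerA.
rewrite V_plusE ?(leq_trans (leq_pred i)) // !scalerA -scalerDl.
case: i id => [|i] _ /=.
  by rewrite !mul0r scale0r -[LHS](scale0r (V_basis 0)); congr (_ *: _); rewrite muln0; ring.
by congr (_ *: _); rewrite natrM -!natr1; ring.
Qed.

Definition V_action : sl2Action 'rV[rat]_d.+1 :=
  Sl2Action V_h_plus V_h_minus V_plus_minus.

End StandardModule.

Section SymmetricPower.
Context (m : nat).

(* The symmetric algebra of Q^m is the polynomial ring on the coordinate basis,
   in which a vector w is the linear form symalg_incl w; see symalg_universal. *)
Definition symalg_incl : 'rV[rat]_m -> {mpoly rat[m]} := lin_ext (fun i => 'X_i).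

HB.instance Definition _ := GRing.Linear.on symalg_incl.

Lemma symalg_universal (B : comAlgType rat) (g : {linear 'rV[rat]_m -> B}) :
  exists F : {lrmorphism {mpoly rat[m]} -> B},
    (forall w, F (symalg_incl w) = g w) /\
    forall G : {lrmorphism {mpoly rat[m]} -> B},
      (forall w, G (symalg_incl w) = g w) -> G =1 F.
Proof.
pose a := mmap (GRing.in_alg B) (fun i => g (delta_mx 0 i)).
have aZ : scalable a by move=> c p; rewrite /a mmapZ mulr_algl.
pose F := HB.pack_for {lrmorphism {mpoly rat[m]} -> B} a
  (GRing.isScalable.Build rat {mpoly rat[m]} B *:%R a aZ).
have FX i : a 'X_i = g (delta_mx 0 i) by rewrite /a mmapX mmap1U.
exists F; split=> [w|G Gg p].
  rewrite {2}[w]row_sum_delta /symalg_incl /lin_ext !linear_sum.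
  by apply: eq_bigr => i _; rewrite !linearZ /= FX.
have GX i : G 'X_i = a 'X_i.
  by rewrite FX -Gg /symalg_incl lin_ext_delta.
elim/mpolyind: p => [|c k p _ _ IH]; first by rewrite !linear0.
rewrite !linearD !linearZ /=; congr (_ *: _ + _); last exact: IH.
rewrite mpolyXE_id (rmorph_prod G) [a _](rmorph_prod F) /=.
by apply: eq_bigr => i _; rewrite (rmorphXn G) [a _](rmorphXn F) /= GX.
Qed.

(* The unique derivation of the symmetric algebra extending the endomorphism f;
   see symalg_derM, symalg_der_incl and symalg_der_unique. *)
Definition symalg_der (f : 'rV[rat]_m -> 'rV[rat]_m) :
    {mpoly rat[m]} -> {mpoly rat[m]} :=
  vfield (fun i => symalg_incl (f (delta_mx 0 i))).

HB.instance Definition _ f := GRing.Linear.on (symalg_der f).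

Lemma symalg_derM f p q :
  symalg_der f (p * q) = symalg_der f p * q + p * symalg_der f q.
Proof. exact: vfieldM. Qed.

Lemma symalg_der_incl (f : {linear 'rV[rat]_m -> 'rV[rat]_m}) w :
  symalg_der f (symalg_incl w) = symalg_incl (f w).
Proof.
have E : symalg_incl w = \sum_i w 0 i *: 'X_i by [].
rewrite E [w in RHS]row_sum_delta !linear_sum /=.
by apply: eq_bigr => i _; rewrite !linearZ /= [symalg_der f _]vfieldX.
Qed.

Lemma symalg_der_unique (f : {linear 'rV[rat]_m -> 'rV[rat]_m})
    (D : {linear {mpoly rat[m]} -> {mpoly rat[m]}}) :
  (forall p q, D (p * q) = D p * q + p * D q) ->
  (forall w, D (symalg_incl w) = symalg_incl (f w)) ->
  D =1 symalg_der f.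
Proof.
move=> DM Df; apply: derivation_vfield => // i.
by rewrite -Df /symalg_incl lin_ext_delta.
Qed.

Lemma symalg_der_bracket (f g h : {linear 'rV[rat]_m -> 'rV[rat]_m}) c :
  (forall w, f (g w) - g (f w) = c *: h w) ->
  forall p, symalg_der f (symalg_der g p) - symalg_der g (symalg_der f p) =
    c *: symalg_der h p.
Proof.
move=> fgh p; rewrite vfield_bracket -vfieldZl; apply: eq_vfield => i.
rewrite /vbracket -/(symalg_der f _) -/(symalg_der g _) !symalg_der_incl.
by rewrite -linearB fgh linearZ.
Qed.

Context (A : sl2Action 'rV[rat]_m).

Lemma symalg_h_plus p :
  symalg_der (h_act A) (symalg_der (e_plus A) p) -
  symalg_der (e_plus A) (symalg_der (h_act A) p) =
  2%:R *: symalg_der (e_plus A) p.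
Proof. by apply: symalg_der_bracket => w; apply: sl2_h_plus. Qed.

Lemma symalg_h_minus p :
  symalg_der (h_act A) (symalg_der (e_minus A) p) -
  symalg_der (e_minus A) (symalg_der (h_act A) p) =
  - (2%:R *: symalg_der (e_minus A) p).
Proof.
rewrite -scaleNr; apply: symalg_der_bracket => w.
by rewrite sl2_h_minus scaleNr.
Qed.

Lemma symalg_plus_minus p :
  symalg_der (e_plus A) (symalg_der (e_minus A) p) -
  symalg_der (e_minus A) (symalg_der (e_plus A) p) =
  symalg_der (h_act A) p.
Proof.
rewrite -[RHS]scale1r; apply: symalg_der_bracket => w.
by rewrite sl2_plus_minus scale1r.
Qed.

Definition symalg_action : sl2Action {mpoly rat[m]} :=
  Sl2Action symalg_h_plus symalg_h_minus symalg_plus_minus.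

Context (n : nat).

Definition symalg_degree : pred {mpoly rat[m]} := fun p => p \is n.-homog.

Lemma symalg_degree_closed : submod_closed symalg_degree.
Proof. exact: (@dhomog_submod_closed m rat mdeg n). Qed.

Lemma symalg_degree_der f p :
  p \in symalg_degree -> symalg_der f p \in symalg_degree.
Proof.
rewrite /in_mem /= /symalg_degree => /dhomogP hp.
have incl1 w : symalg_incl w \is 1.-homog.
  by apply: rpred_sum => i _; apply: rpredZ; rewrite dhomogX /= mdeg1.
rewrite [p]mpolyE big_seq_cond linear_sum; apply: rpred_sum => k /andP[/hp nk _].
rewrite linearZ; apply: rpredZ; apply: rpred_sum => i _; rewrite mderivX.
have [->|ki] := eqVneq (k i) 0%N; first by rewrite scale0r mulr0 rpred0.
rewrite -scalerAr; apply: rpredZ.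
have Uk : (U_(i) <= k)%MM by rewrite lep1mP.
have dk : (1 + mdeg (k - U_(i))%MM)%N = n.
  by rewrite -(mdeg1 i) -mdegD addmC submK.
by rewrite -dk; apply: dhomogM; rewrite ?dhomogX.
Qed.

Definition Sym_submodule : sl2_submodule symalg_action symalg_degree :=
  @Sl2Submodule _ symalg_action _ symalg_degree_closed
    (@symalg_degree_der (e_plus A)) (@symalg_degree_der (h_act A))
    (@symalg_degree_der (e_minus A)).

Definition Sym : lmodType rat := sub_space symalg_degree_closed.

Definition Sym_action : sl2Action Sym := sub_action Sym_submodule.

End SymmetricPower.

(* Main.v *)
(** The operators act on [x^i], [i <= d], as [sl_2] acts on [v_i], so the
    polynomials of degree at most [d] in each variable form the tensor power
    [V_d^(x)n], with [x_1^(a_1) ... x_n^(a_n)] playing the role of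
    [v_(a_1) (x) ... (x) v_(a_n)], and the symmetric ones are its invariants
    under the symmetric group.  The multiplication map to [Sym^n(V_d)] is
    equivariant because both sides obey the Leibniz rule.  On symmetric
    polynomials it is invertible in characteristic 0: a coefficient is constant
    on each orbit of exponents, i.e. on each fiber of the map sending a tuple to
    its multiset of entries, so the inverse divides by the size of that fiber. *)

From HB Require Import structures.
Require Import Defs.
From mathcomp Require Import all_boot all_order all_algebra all_fingroup.
From mathcomp Require Import mpoly.

Set Implicit Arguments.
Unset Strict Implicit.
Unset Printing Implicit Defensive.

Import GRing.Theory.

Local Open Scope ring_scope.

Lemma vfield_prod n (u : 'I_n -> {mpoly rat[n]}) l (F : 'I_l -> {mpoly rat[n]}) :
  vfield u (\prod_j F j) =
    \sum_k \prod_j (if j == k then vfield u (F j) else F j).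
Proof.
elim: l F => [|l IH] F.
  by rewrite !big_ord0; apply: (derivation1 (vfieldM u)).
rewrite big_ord_recl vfieldM IH [RHS]big_ord_recl; congr (_ + _).
  by rewrite big_ord_recl eqxx.
rewrite mulr_sumr; apply: eq_bigr => k _; rewrite big_ord_recl /=; congr (_ * _).
Qed.

Lemma symalg_der_prod m (f : 'rV[rat]_m -> 'rV[rat]_m) l
    (F : 'I_l -> {mpoly rat[m]}) :
  symalg_der f (\prod_j F j) =
    \sum_k \prod_j (if j == k then symalg_der f (F j) else F j).
Proof. exact: vfield_prod. Qed.

Section Monomials.
Context (n d : nat).
Implicit Types (p : {mpoly rat[n]}) (m : 'X_{1..n}).

Definition mnm_upd m (k : 'I_n) (i : nat) : 'X_{1..n} :=
  [multinom if j == k then i else m j | j < n].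

Lemma mnm_upd_id m k : mnm_upd m k (m k) = m.
Proof. by apply/mnmP => j; rewrite mnmE; case: eqP => [->|]. Qed.

Lemma mnm_updS m k : mnm_upd m k (m k).+1 = (U_(k) + m)%MM.
Proof.
apply/mnmP => j; rewrite mnmE mnmDE mnm1E eq_sym.
by case: eqP => [->|_]; rewrite ?add1n.
Qed.

Lemma mnm_upd_pred m k : mnm_upd m k (m k).-1 = (m - U_(k))%MM.
Proof.
apply/mnmP => j; rewrite mnmE mnmBE mnm1E eq_sym.
by case: eqP => [->|_]; rewrite ?subn1 ?subn0.
Qed.

Lemma poly_plusX m :
  poly_plus d 'X_[m] =
    \sum_k (d%:R - (m k)%:R) *: 'X_[mnm_upd m k (m k).+1].
Proof.
apply: eq_bigr => k _; rewrite mnm_updS mderivX -scalerAr -mpolyXD scalerBl.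
rewrite addrC; congr (_ - _).
have [-> |mk] := eqVneq (m k) 0%N; first by rewrite !scale0r.
congr (_ *: _); rewrite expr2 -mulrA -!mpolyXD; congr 'X_[_ + _].
by rewrite addmC submK // lep1mP.
Qed.

Lemma poly_hX m :
  poly_h d 'X_[m] =
    \sum_k ((2 * m k)%:R - d%:R) *: 'X_[mnm_upd m k (m k)].
Proof.
rewrite /poly_h scaler_sumr (eq_bigr (fun k => (2 * m k)%:R *: 'X_[m])).
  under [RHS]eq_bigr do rewrite mnm_upd_id.
  rewrite -!scaler_suml -scalerBl sumrB; congr ((_ - _) *: _).
  by rewrite sumr_const card_ord mulnC natrM mulr_natr.
move=> k _; rewrite mderivX natrM -scalerAr -scalerA; congr (_ *: _).
have [-> |mk] := eqVneq (m k) 0%N; first by rewrite !scale0r.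
by congr (_ *: _); rewrite -mpolyXD addmC submK // lep1mP.
Qed.

Lemma poly_minusX m :
  poly_minus 'X_[m] = \sum_k (m k)%:R *: 'X_[mnm_upd m k (m k).-1] :> {mpoly rat[n]}.
Proof. by apply: eq_bigr => k _; rewrite mderivX mnm_upd_pred. Qed.

Definition deg_le : pred {mpoly rat[n]} :=
  fun p => all (fun m : 'X_{1..n} => [forall k, (m k <= d)%N]) (msupp p).

Lemma deg_leP p :
  reflect (forall m, p@_m != 0 -> forall k, (m k <= d)%N) (p \in deg_le).
Proof.
apply: (iffP allP) => H m.
  by rewrite -mcoeff_msupp => /H/forallP.
by rewrite mcoeff_msupp => /H/forallP.
Qed.

Lemma deg_le_closed : submod_closed deg_le.
Proof.
split=> [|c p q /deg_leP Hp /deg_leP Hq].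
  by apply/deg_leP => m; rewrite mcoeff0 eqxx.
apply/deg_leP => m; rewrite mcoeffD mcoeffZ.
have [->|/Hp //] := eqVneq p@_m 0; rewrite mulr0 add0r; exact: Hq.
Qed.

HB.instance Definition _ :=
  GRing.isSubmodClosed.Build rat {mpoly rat[n]} deg_le deg_le_closed.

Lemma deg_leX m : ('X_[m] \in deg_le) = [forall k, (m k <= d)%N].
Proof. by rewrite /in_mem /= /deg_le msuppX /= andbT. Qed.

Definition tmnm (t : n.-tuple 'I_d.+1) : 'X_{1..n} :=
  [multinom (tnth t k : nat) | k < n].

Lemma tmnm_inj : injective tmnm.
Proof.
move=> t u /mnmP tu; apply: eq_from_tnth => k; apply: val_inj.
by have := tu k; rewrite !mnmE.
Qed.

Lemma tmnm_deg_le t : 'X_[tmnm t] \in deg_le.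
Proof. by rewrite deg_leX; apply/forallP => k; rewrite mnmE -ltnS. Qed.

Lemma tmnm_surj m : (forall k, (m k <= d)%N) -> exists t, m = tmnm t.
Proof.
move=> md; exists [tuple inord (m k) | k < n].
by apply/mnmP => k; rewrite mnmE tnth_mktuple inordK // ltnS.
Qed.

Lemma mcoeff_tmnm_sum (c : n.-tuple 'I_d.+1 -> rat) u :
  (\sum_t c t *: 'X_[tmnm t])@_(tmnm u) = c u.
Proof.
rewrite raddf_sum (bigD1 u) //= mcoeffZ mcoeffX eqxx mulr1 big1 ?addr0 //.
by move=> t tu; rewrite mcoeffZ mcoeffX (inj_eq tmnm_inj) (negPf tu) mulr0.
Qed.

Lemma tmnm_sum_deg_le c : \sum_t c t *: 'X_[tmnm t] \in deg_le.
Proof. by apply: rpred_sum => t _; apply: rpredZ; apply: tmnm_deg_le. Qed.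

Lemma deg_leE p : p \in deg_le -> p = \sum_t p@_(tmnm t) *: 'X_[tmnm t].
Proof.
move=> pd; apply/mpolyP => m; apply/eqP; rewrite -subr_eq0 -mcoeffB.
apply: contraT => nz.
have [t mt]: exists t, m = tmnm t.
  by apply/tmnm_surj/(deg_leP _ _ _ nz); rewrite rpredB ?tmnm_sum_deg_le.
by move: nz; rewrite mt mcoeffB mcoeff_tmnm_sum subrr eqxx.
Qed.

Lemma s2m_sum (t : n.-tuple 'I_d.+1) : s2m t = (\sum_k U_(tnth t k))%MM.
Proof.
apply/mnmP => i; rewrite mnmE mnm_sumE -sum1_count big_tuple big_mkcond.
by apply: eq_bigr => k _; rewrite mnm1E /=; case: (_ == i).
Qed.

Lemma mdeg_s2m (t : n.-tuple 'I_d.+1) : mdeg (s2m t) = n.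
Proof.
rewrite s2m_sum mdeg_sum (eq_bigr (fun=> 1%N)); last by move=> k _; rewrite mdeg1.
by rewrite sum1_card card_ord.
Qed.

Lemma s2m_surj (m : 'X_{1..d.+1}) :
  mdeg m = n -> exists t : n.-tuple 'I_d.+1, s2m t = m.
Proof.
move=> mn; have sz : size (m2s m) == n by rewrite size_m2s mn.
by exists (Tuple sz); rewrite /= s2mK.
Qed.

Definition tperm_act (s : 'S_n) (t : n.-tuple 'I_d.+1) : n.-tuple 'I_d.+1 :=
  [tuple tnth t (s k) | k < n].

Lemma tperm_act_inj s : injective (tperm_act s).
Proof.
move=> t u tu; apply: eq_from_tnth => k.
by have := congr1 (fun v => tnth v (s^-1 k)%g) tu; rewrite !tnth_mktuple permKV.
Qed.

Lemma s2m_tperm s t : s2m (tperm_act s t) = s2m t.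
Proof.
apply/mnmP => i; rewrite !mnmE; apply/seq.permP.
by apply/tuple_permP; exists s.
Qed.

Lemma s2m_eq_tperm (t u : n.-tuple 'I_d.+1) :
  s2m t = s2m u -> exists s, t = tperm_act s u.
Proof.
move=> /mnmP tu; have /tuple_permP[s ts] : perm_eq t u.
  by apply/allP => i _ /=; have := tu i; rewrite !mnmE => ->.
by exists s; apply: val_inj.
Qed.

Lemma tmnm_tperm s t :
  tmnm (tperm_act s t) = [multinom tmnm t (s k) | k < n].
Proof. by apply/mnmP => k; rewrite !mnmE tnth_mktuple. Qed.

Lemma mcoeff_sym_tmnm p (t u : n.-tuple 'I_d.+1) :
  p \is symmetric -> s2m t = s2m u -> p@_(tmnm t) = p@_(tmnm u).
Proof.
by move=> /issymP sp /s2m_eq_tperm[s ->]; rewrite tmnm_tperm -mcoeff_sym sp.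
Qed.

(* The multiplication map from the tensor power to the symmetric power;
   monomials with an exponent above d are sent to 0. *)
Definition to_sym p : {mpoly rat[d.+1]} :=
  \sum_(t : n.-tuple 'I_d.+1) p@_(tmnm t) *: 'X_[s2m t].

Lemma to_sym_is_linear : linear to_sym.
Proof.
move=> c p q; rewrite /to_sym scaler_sumr -big_split; apply: eq_bigr => t _ /=.
by rewrite mcoeffD mcoeffZ scalerDl scalerA.
Qed.

HB.instance Definition _ := GRing.isLinear.Build rat {mpoly rat[n]}
  {mpoly rat[d.+1]} _ to_sym to_sym_is_linear.

Lemma to_sym_homog p : to_sym p \is n.-homog.
Proof.
apply: rpred_sum => t _; apply: rpredZ; rewrite dhomogX; exact/eqP/mdeg_s2m.
Qed.

Lemma mcoeff_to_sym p (m : 'X_{1..d.+1}) :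
  (to_sym p)@_m = \sum_(t : n.-tuple 'I_d.+1 | s2m t == m) p@_(tmnm t).
Proof.
rewrite raddf_sum [RHS]big_mkcond; apply: eq_bigr => t _ /=.
by rewrite mcoeffZ mcoeffX; case: eqP; rewrite ?mulr1 ?mulr0.
Qed.

Lemma to_symX m : to_sym 'X_[m] = \prod_k symalg_incl (V_basis d (m k)).
Proof.
have [/forallP md|/forallPn[k mk]] := boolP [forall k, (m k <= d)%N]; last first.
  rewrite (bigD1 k) //= V_basis0 1?ltnNge // linear0 mul0r.
  apply: big1 => t _; rewrite mcoeffX; case: eqP => [mt|]; last by rewrite scale0r.
  by case/negP: mk; rewrite mt mnmE -ltnS.
have [t ->] := tmnm_surj md.
rewrite /to_sym (bigD1 t) //= mcoeffX eqxx scale1r big1 ?addr0 => [|u ut].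
  rewrite s2m_sum -mprodXE; apply: eq_bigr => k _.
  by rewrite mnmE V_basisE /symalg_incl lin_ext_delta.
by rewrite mcoeffX (inj_eq tmnm_inj) eq_sym (negPf ut) scale0r.
Qed.

Section Slotwise.
Context (T : {linear {mpoly rat[n]} -> {mpoly rat[n]}}).
Context (f : {linear 'rV[rat]_d.+1 -> 'rV[rat]_d.+1}).
Context (c : nat -> rat) (tau : nat -> nat).
Hypothesis TX :
  forall m, T 'X_[m] = \sum_k c (m k) *: 'X_[mnm_upd m k (tau (m k))].
Hypothesis fV :
  forall i, (i <= d)%N -> f (V_basis d i) = c i *: V_basis d (tau i).
Hypothesis tau_le : forall i, (i <= d)%N -> c i != 0 -> (tau i <= d)%N.

Lemma deg_le_slotwise p : p \in deg_le -> T p \in deg_le.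
Proof.
move=> /deg_leE ->; rewrite linear_sum; apply: rpred_sum => t _.
rewrite linearZ; apply: rpredZ; rewrite TX; apply: rpred_sum => k _.
have td j : (tmnm t j <= d)%N by rewrite mnmE -ltnS.
have [->|/(tau_le (td k)) tk] := eqVneq (c (tmnm t k)) 0.
  by rewrite scale0r rpred0.
apply: rpredZ; rewrite deg_leX; apply/forallP => j.
by rewrite mnmE; case: eqP.
Qed.

Lemma to_sym_slotwise p :
  p \in deg_le -> to_sym (T p) = symalg_der f (to_sym p).
Proof.
move=> /deg_leE ->; rewrite (linear_sum T) !(linear_sum to_sym) linear_sum.
apply: eq_bigr => t _; rewrite !linearZ /=; congr (_ *: _).
rewrite TX linear_sum to_symX symalg_der_prod; apply: eq_bigr => k _.
have tk : (tmnm t k <= d)%N by rewrite mnmE -ltnS.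
rewrite linearZ /= to_symX (bigD1 k) //= [in RHS](bigD1 k) //= eqxx.
rewrite symalg_der_incl fV // linearZ /= [mnm_upd _ _ _ _]mnmE eqxx scalerAl.
congr (_ * _); apply: eq_bigr => j /negPf jk.
by rewrite [mnm_upd _ _ _ _]mnmE jk.
Qed.

End Slotwise.

Let plus_le (i : nat) : (i <= d)%N -> d%:R - i%:R != 0 :> rat -> (i.+1 <= d)%N.
Proof.
by rewrite leq_eqVlt => /orP[/eqP ->|//]; rewrite subrr eqxx.
Qed.

Let minus_le (i : nat) : (i <= d)%N -> i%:R != 0 :> rat -> (i.-1 <= d)%N.
Proof. by move=> id _; apply: leq_trans id; apply: leq_pred. Qed.

Lemma deg_le_plus p : p \in deg_le -> poly_plus d p \in deg_le.
Proof. exact: (deg_le_slotwise (T := @poly_plus n d) poly_plusX plus_le). Qed.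

Lemma deg_le_h p : p \in deg_le -> poly_h d p \in deg_le.
Proof.
exact: (deg_le_slotwise (T := @poly_h n d) (tau := id)
  (c := fun i => (2 * i)%:R - d%:R) poly_hX (fun _ id _ => id)).
Qed.

Lemma deg_le_minus p : p \in deg_le -> poly_minus p \in deg_le.
Proof. exact: (deg_le_slotwise (T := @poly_minus n) poly_minusX minus_le). Qed.

Lemma to_sym_plus p : p \in deg_le ->
  to_sym (poly_plus d p) = symalg_der (@V_plus d) (to_sym p).
Proof.
exact: (to_sym_slotwise (T := @poly_plus n d) (f := @V_plus d) poly_plusX
  (@V_plusE d)).
Qed.

Lemma to_sym_h p : p \in deg_le ->
  to_sym (poly_h d p) = symalg_der (@V_h d) (to_sym p).
Proof.
exact: (to_sym_slotwise (T := @poly_h n d) (f := @V_h d) poly_hX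
  (fun i _ => @V_hE d i)).
Qed.

Lemma to_sym_minus p : p \in deg_le ->
  to_sym (poly_minus p) = symalg_der (@V_minus d) (to_sym p).
Proof.
exact: (to_sym_slotwise (T := @poly_minus n) (f := @V_minus d) poly_minusX
  (@V_minusE d)).
Qed.

Definition s2m_fiber (m : 'X_{1..d.+1}) : nat :=
  #|[pred t : n.-tuple 'I_d.+1 | s2m t == m]|.

Lemma s2m_fiber_neq0 (t : n.-tuple 'I_d.+1) : (s2m_fiber (s2m t))%:R != 0 :> rat.
Proof.
rewrite Num.Theory.pnatr_eq0 -lt0n; apply/card_gt0P; exists t.
by rewrite inE.
Qed.

Definition of_sym (q : {mpoly rat[d.+1]}) : {mpoly rat[n]} :=
  \sum_(t : n.-tuple 'I_d.+1) (q@_(s2m t) / (s2m_fiber (s2m t))%:R) *: 'X_[tmnm t].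

Lemma of_sym_deg_le q : of_sym q \in deg_le.
Proof. exact: tmnm_sum_deg_le. Qed.

Lemma of_sym_sym q : of_sym q \is symmetric.
Proof.
apply/issymP => s; rewrite linear_sum /= [RHS](reindex_inj (@tperm_act_inj s^-1%g)).
apply: eq_bigr => t _; rewrite s2m_tperm linearZ /=; congr (_ *: _).
by rewrite msymX tmnm_tperm.
Qed.

Lemma to_symK p : p \is symmetric -> p \in deg_le -> of_sym (to_sym p) = p.
Proof.
move=> sp /deg_leE {2}->; apply: eq_bigr => t _; congr (_ *: _).
rewrite mcoeff_to_sym (eq_bigr (fun=> p@_(tmnm t))); last first.
  by move=> u /eqP; apply: mcoeff_sym_tmnm.
by rewrite sumr_const -[X in X / _]mulr_natr mulfK // s2m_fiber_neq0.
Qed.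

Lemma of_symK q : q \is n.-homog -> to_sym (of_sym q) = q.
Proof.
move=> /dhomogP qn; apply/mpolyP => m; rewrite mcoeff_to_sym.
rewrite (eq_bigr (fun=> q@_m / (s2m_fiber m)%:R)); last first.
  by move=> t /eqP <-; rewrite mcoeff_tmnm_sum.
rewrite sumr_const -/(s2m_fiber m) -[LHS]mulr_natr.
have [->|] := eqVneq q@_m 0; first by rewrite !mul0r.
rewrite -mcoeff_msupp => /qn /s2m_surj[t <-].
by rewrite divfK // s2m_fiber_neq0.
Qed.

Lemma Lambda_deg_le_closed : submod_closed (Lambda_deg_le (n := n) d).
Proof.
have [d0 dL] := deg_le_closed; split=> [|c u v]; first exact: d0.
exact: dL.
Qed.

Lemma Lambda_deg_le_submodule :
  sl2_submodule (Lambda_action n d) (Lambda_deg_le (n := n) d).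
Proof.
split=> [|u|u|u]; first exact: Lambda_deg_le_closed.
- exact: deg_le_plus.
- exact: deg_le_h.
- exact: deg_le_minus.
Qed.

End Monomials.

Lemma finite_dimensional_iso (V W : lmodType rat) (f : {linear V -> W}) :
  bijective f -> finite_dimensional W -> finite_dimensional V.
Proof.
move=> bf [m [[g gl bg]]]; exists m; split; exists (g \o f).
  by move=> c u v /=; rewrite linearP gl.
exact: bij_comp.
Qed.

Lemma finite_dimensional_Sym d n : finite_dimensional (Defs.Sym d.+1 n).
Proof.
have [g gl bg] := dhomog_vecaxiom d rat n.
exists 'C(n + d, n); split.
exists (fun u : Defs.Sym d.+1 n => g (DHomog (valP u))).
  move=> c u v; rewrite -gl; congr g; exact: val_inj.
apply: (bij_comp bg).
exists (fun p : dhomog d.+1 rat n =>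
  SubSpace (symalg_degree_closed d.+1 n) (dhomog_is_dhomog p)).
  by move=> u; apply: val_inj.
by move=> u; apply: val_inj.
Qed.

Section Isomorphism.
Context (n d : nat).

Let LambdaD := sub_space (sub_closed (Lambda_deg_le_submodule n d)).

Definition Lambda_to_Sym (u : LambdaD) : Defs.Sym d.+1 n :=
  SubSpace (symalg_degree_closed d.+1 n) (to_sym_homog d (val (val u))).

Lemma Lambda_to_Sym_is_linear : linear Lambda_to_Sym.
Proof. by move=> c u v; apply: val_inj; rewrite /= linearP. Qed.

HB.instance Definition _ := GRing.isLinear.Build rat LambdaD (Defs.Sym d.+1 n) _
  Lambda_to_Sym Lambda_to_Sym_is_linear.

Lemma Lambda_to_Sym_bij : bijective Lambda_to_Sym.
Proof.
pose g (q : Defs.Sym d.+1 n) : LambdaD :=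
  SubSpace (sub_closed (Lambda_deg_le_submodule n d))
    (sub_vec := SubSpace (symmetric_closed n) (of_sym_sym n (val q)))
    (of_sym_deg_le n (val q)).
exists g => u; apply: val_inj; last by apply: of_symK; apply: (valP u).
apply: val_inj; apply: to_symK; [exact: (valP (val u)) | exact: (valP u)].
Qed.

Lemma Lambda_iso_Sym : sl2_isomorphic (sub_action (Lambda_deg_le_submodule n d))
  (Sym_action (V_action d) n).
Proof.
exists Lambda_to_Sym; split=> [|u|u|u]; first exact: Lambda_to_Sym_bij.
- by apply: val_inj; apply: to_sym_plus; apply: (valP u).
- by apply: val_inj; apply: to_sym_h; apply: (valP u).
- by apply: val_inj; apply: to_sym_minus; apply: (valP u).
Qed.

End Isomorphism.

Theorem mainTheorem9 (n d : nat) (hn : (1 <= n)%N) (hd : (1 <= d)%N) :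
  exists H : sl2_submodule (Lambda_action n d) (Lambda_deg_le (n := n) d),
    finite_dimensional (sub_space (sub_closed H)) /\
    sl2_isomorphic (sub_action H) (Sym_action (V_action d) n).
Proof.
exists (Lambda_deg_le_submodule n d); split; last exact: Lambda_iso_Sym.
exact: finite_dimensional_iso (Lambda_to_Sym_bij n d) (finite_dimensional_Sym d n).
Qed.
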